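(* Consider the stochastic process (case 3) describing transmission of photons through a sequence of $M\ge 1$ identical polarization sensitive elements rotated by angles $\vec\alpha=(\alpha_0,\dots,\alpha_{M-1})$, with $N_0\neq 0$ initial photons, with common transmission probability $P_T(\theta_{\mathrm{in}},\alpha)$ and common change density $\rho_C(\theta_{\mathrm{in}},\theta_{\mathrm{out}},\alpha)$ (not depending on $\theta_{\mathrm{in}}$), as defined in the context. Then for every $i\in(0,\dots,M-1)$, $$\frac{N_{i+1}(\vec\alpha)}{N_0}\,\rho_{S,i+1}(\theta_{i+1},\vec\alpha)=\int_{\theta_i}\frac{N_i(\vec\alpha)}{N_0}\,\rho_{S,i}(\theta_i,\vec\alpha)\,P_T(\theta_i,\alpha_i)\,\rho_C(\theta_i,\theta_{i+1},\alpha_i)\,\mathrm{d}\theta_i .$$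
   Context: Process ''case 3''. Photons pass successively through surfaces $\Sigma_0,\dots,\Sigma_M$; the $i$-th polarization sensitive element ($i=0,\dots,M-1$) lies between $\Sigma_i$ and $\Sigma_{i+1}$ and is rotated by a fixed (non-random) angle $\alpha_i$; $\vec\alpha=(\alpha_0,\dots,\alpha_{M-1})$. The state of a photon at $\Sigma_i$ is a random polarization angle $\theta_i$, ranging over a fixed interval of length $2\pi$ with Lebesgue measure $\mathrm{d}\theta_i$; $\int_{\theta_i}$ denotes integration over this interval. $N_0>0$ photons pass through $\Sigma_0$; different photons are independent. The data are: - $\rho_{S,0}(\theta_0,\vec\alpha)$: the probability density of $\theta_0$ (it does not depend on the element rotations). - $P_{T,i}(\theta_i,\alpha_i)\in[0,1]$, measurable: the conditional probability that a photon with polarization angle $\theta_i$ at $\Sigma_i$ is transmitted through the $i$-th element (otherwise it never reaches $\Sigma_{i+1},\dots,\Sigma_M$). - $\rho_{C,i}(\theta_i,\theta_{i+1},\alpha_i)\ge 0$, jointly measurable in $(\theta_i,\theta_{i+1})$, with $\int_{\theta_{i+1}}\rho_{C,i}(\theta_i,\theta_{i+1},\alpha_i)\,\mathrm{d}\theta_{i+1}=1$ for all $\theta_i$: the conditional probability density of the outgoing polarization angle $\theta_{i+1}$, given the incoming angle $\theta_i$ and given that the photon was transmitted through the $i$-th element. In case 3 it is assumed that (a) each $\rho_{C,i}$ does not depend on $\theta_i$, and (b) the elements are identical: there are functions $P_T(\theta_{\mathrm{in}},\alpha)$ and $\rho_C(\theta_{\mathrm{in}},\theta_{\mathrm{out}},\alpha)$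 such that $P_{T,i}(\theta_i,\alpha_i)=P_T(\theta_i,\alpha_i)$ and $\rho_{C,i}(\theta_i,\theta_{i+1},\alpha_i)=\rho_C(\theta_i,\theta_{i+1},\alpha_i)$ for all $i=0,\dots,M-1$. Memoryless (Markov) property: transmission through the $i$-th element and the resulting angle depend on the past only through $\theta_i$. Derived quantities: $N_i(\vec\alpha)$ is the (expected) number of photons which pass through $\Sigma_i$, i.e. $N_0$ times the probability that a photon reaches $\Sigma_i$ (so $N_0(\vec\alpha)=N_0$); $\rho_{S,i}(\theta_i,\vec\alpha)$ is the probability density of the polarization angle at $\Sigma_i$ conditioned on the photon reaching $\Sigma_i$ (both depend on $\vec\alpha$ at most through $\alpha_0,\dots,\alpha_{i-1}$). If $N_i(\vec\alpha)=0$, the product $N_i(\vec\alpha)\rho_{S,i}(\theta_i,\vec\alpha)$ is understood to be $0$. Identities between densities are understood almost everywhere. *)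

(* Defs.v *)
From HB Require Import structures.
From mathcomp Require Import all_boot all_order all_algebra.
From mathcomp Require Import all_classical all_reals all_analysis.

Set Implicit Arguments.
Unset Strict Implicit.
Unset Printing Implicit Defensive.

Import Order.TTheory GRing.Theory Num.Theory.
Import numFieldNormedType.Exports.

Local Open Scope classical_set_scope.
Local Open Scope ring_scope.

(* The interval [J] of polarization angles carries Lebesgue measure.  Surfaces
   are numbered 0..M and elements 0..M-1, so [i : 'I_M] denotes the element
   between surfaces [i] and [i.+1].  For one photon, [reach i] is the event that
   it reaches surface [i] and [theta i w] is its polarization angle there, which
   is meaningful only for [w] in [reach i]; the values of [reach] and [theta]
   at indices above M are irrelevant. *)

Section Elements.
Context {R : realType}.

(* [PT i x a]: probability that the [i]-th element, rotated by [a], transmits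
   a photon of incoming angle [x]. *)
Definition transmission_probabilities (J : interval R) (M : nat)
    (PT : 'I_M -> R -> R -> R) : Prop :=
  forall (i : 'I_M) (a : R),
    measurable_fun [set` J] (fun x => PT i x a) /\
    (forall x, x \in J -> 0 <= PT i x a <= 1).

(* [rhoC i x y a]: density of the outgoing angle [y] given the incoming angle
   [x], for the [i]-th element rotated by [a]. *)
Definition change_densities (J : interval R) (M : nat)
    (rhoC : 'I_M -> R -> R -> R -> R) : Prop :=
  forall (i : 'I_M) (a : R),
    [/\ measurable_fun ([set` J] `*` [set` J])
          (fun p : R * R => rhoC i p.1 p.2 a),
        (forall x y, x \in J -> y \in J -> 0 <= rhoC i x y a) &
        (forall x, x \in J ->
           (\int[lebesgue_measure]_(y in [set` J]) (rhoC i x y a)%:E = 1)%E)].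

Definition case3 (J : interval R) (M : nat)
    (PTs : 'I_M -> R -> R -> R) (rhoCs : 'I_M -> R -> R -> R -> R)
    (PT : R -> R -> R) (rhoC : R -> R -> R -> R) : Prop :=
  [/\ (forall (i : 'I_M) x x' y a, x \in J -> x' \in J -> y \in J ->
         rhoCs i x y a = rhoCs i x' y a),
      (forall (i : 'I_M) x a, x \in J -> PTs i x a = PT x a) &
      (forall (i : 'I_M) x y a, x \in J -> y \in J ->
         rhoCs i x y a = rhoC x y a)].

End Elements.

Section Process.
Context {R : realType} {d : measure_display} {T : measurableType d}.
Variable P : probability T R.

(* [rho] is a density, with respect to Lebesgue measure on [J], of the law of
   [X] conditioned on the event [E]; no condition when [P E = 0]. *)
Definition cond_density (J : interval R) (E : set T) (X : T -> R)
    (rho : R -> R) : Prop :=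
  P E != 0%E ->
  [/\ measurable_fun [set` J] rho,
      (forall x, x \in J -> 0 <= rho x) &
      (forall B : set R, measurable B ->
         (fine (P (E `&` X @^-1` B)) / fine (P E))%:E =
         (\int[lebesgue_measure]_(x in [set` J] `&` B) (rho x)%:E)%E)].

(* [f] is a version of the conditional probability of [E] given the trace
   sigma-algebra [G] (Kolmogorov).  When [G] lives on an event [D], this is
   conditioning on [D] as well, the normalization [P D] cancelling out. *)
Definition cond_prob (G : set (set T)) (E : set T) (f : T -> \bar R) : Prop :=
  forall A, G A -> (P (A `&` E) = \int[P]_(w in A) f w)%E.

Definition generated_on (D : set T) (X : T -> R) : set (set T) :=
  [set A | exists2 B : set R, measurable B & A = D `&` X @^-1` B].

(* The sigma-algebra generated on [reach i] by [theta 0], ..., [theta i]. *)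
Definition past (reach : nat -> set T) (theta : nat -> T -> R) (i : nat) :
    set (set T) :=
  <<s reach i, [set A | exists2 k : nat, (k <= i)%N &
                          generated_on (reach i) (theta k) A] >>.

Record photon (J : interval R) (M : nat) (alpha : 'I_M -> R)
    (PT : 'I_M -> R -> R -> R) (rhoC : 'I_M -> R -> R -> R -> R)
    (rho0 : R -> R) (reach : nat -> set T) (theta : nat -> T -> R) : Prop := {
  photon_measurable_reach : forall i : 'I_M.+1, measurable (reach i);
  photon_measurable_theta : forall i : 'I_M.+1,
    measurable_fun (reach i) (theta i);
  photon_range : forall (i : 'I_M.+1) w, reach i w -> theta i w \in J;
  photon_start : reach 0%N = setT;
  photon_absorbed : forall i : 'I_M, reach i.+1 `<=` reach i;
  photon_initial : cond_density J (reach 0%N) (theta 0%N) rho0;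
  photon_transmission : forall i : 'I_M,
    cond_prob (generated_on (reach i) (theta i)) (reach i.+1)
      (fun w => (PT i (theta i w) (alpha i))%:E);
  photon_change : forall (i : 'I_M) (B : set R), measurable B ->
    cond_prob (generated_on (reach i.+1) (theta i)) (theta i.+1 @^-1` B)
      (fun w => (\int[lebesgue_measure]_(y in [set` J] `&` B)
                   (rhoC i (theta i w) y (alpha i))%:E)%E);
  (* given the whole past, the probability of being transmitted with outgoing
     angle in [B] is a function of the current angle only *)
  photon_markov : forall (i : 'I_M) (B : set R), measurable B ->
    exists kappa : R -> R,
      [/\ measurable_fun [set` J] kappa,
          (forall x, x \in J -> 0 <= kappa x <= 1) &
          cond_prob (past reach theta i) (reach i.+1 `&` theta i.+1 @^-1` B)
            (fun w => (kappa (theta i w))%:E)] }.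

Definition photon_events (M : nat) (reach : nat -> set T)
    (theta : nat -> T -> R) : set (set T) :=
  <<s [set A | exists2 k : nat, (k <= M)%N &
                 generated_on (reach k) (theta k) A] >>.

(* Taking some of the [A j] to be [setT] gives the product rule for every
   subfamily. *)
Definition independent_photons (M N0 : nat) (reach : 'I_N0 -> nat -> set T)
    (theta : 'I_N0 -> nat -> T -> R) : Prop :=
  forall A : 'I_N0 -> set T,
    (forall j, photon_events M (reach j) (theta j) (A j)) ->
    fine (P (\bigcap_(j in setT) A j)) = \prod_(j < N0) fine (P (A j)).

(* Expected number of photons, among [N0], which pass through surface [i]. *)
Definition expected_photons (N0 : nat) (reach : 'I_N0 -> nat -> set T)
    (i : nat) : R :=
  fine ('E_P[fun w => (\sum_(j < N0) \1_(reach j i) w)%R])%E.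

End Process.

(* Main.v *)
(* As the outgoing density [c] does not depend on the incoming angle, the law
   of the angle at surface i+1, restricted to the photons reaching it, has
   density [p_{i+1} c], where [p_i] is the probability of reaching surface i.
   In the integral on the right-hand side, [c] factors out and what remains is
   the probability of reaching surface i and then being transmitted, that is
   [p_{i+1}].  The [p_i], determined by the same recursion for every photon,
   are the ratios [N_i / N_0]. *)
Require Import Defs.
From HB Require Import structures.
From mathcomp Require Import all_boot all_order all_algebra.
From mathcomp Require Import all_classical all_reals all_analysis.
From mathcomp Require Import measurable_realfun.

Set Implicit Arguments.
Unset Strict Implicit.
Unset Printing Implicit Defensive.

Import Order.TTheory GRing.Theory Num.Theory.
Import numFieldNormedType.Exports.

Local Open Scope classical_set_scope.
Local Open Scope ring_scope.

(** * Change of variables for a law with a density *)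

Section LawWithDensity.
Local Open Scope ereal_scope.
Context d1 d2 (T1 : measurableType d1) (T2 : measurableType d2) (R : realType).
Variables (mu : {measure set T1 -> \bar R}) (nu : {measure set T2 -> \bar R}).
Variables (D : set T1) (E : set T2) (X : T1 -> T2) (g : T2 -> R).
Hypotheses (mD : measurable D) (mE : measurable E).
Hypotheses (mX : measurable_fun D X) (XE : forall w, D w -> E (X w)).
Hypotheses (mg : measurable_fun E g) (g0 : forall y, E y -> (0 <= g y)%R).
Hypothesis lawX : forall B, measurable B ->
  mu (D `&` X @^-1` B) = \int[nu]_(y in E `&` B) (g y)%:E.

Import HBNNSimple.

(** By linearity over the finite range of [h], this reduces to the indicator of one level set, where
    it is [lawX]. *)
Lemma integral_law_nnsfun (h : {nnsfun T2 >-> R}) :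
  \int[mu]_(w in D) (h (X w))%:E = \int[nu]_(y in E) ((h y)%:E * (g y)%:E).
Proof.
have mA r : measurable (h @^-1` [set r]).
  by rewrite -[X in measurable X]setTI; exact: measurable_funP.
transitivity (\int[mu]_(w in D)
   (\sum_(r \in range h) (r * \1_(h @^-1` [set r]) (X w))%:E)).
  by apply: eq_integral => w _; rewrite [in LHS]fimfunE -fsumEFin.
have mfX r : measurable_fun D
    (fun w => (r * \1_(h @^-1` [set r]) (X w))%:E).
  apply/measurable_EFinP; apply: measurable_funM => //.
  by apply: (measurable_comp measurableT) => //; exact: measurable_indic.
rewrite ge0_integral_fsum//; last first.
  by move=> r w _; exact: (nnfun_muleindic_ge0 _ _ (X w)).
transitivity (\int[nu]_(y in E)
   (\sum_(r \in range h) (r * \1_(h @^-1` [set r]) y)%:E * (g y)%:E));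
  last first.
  apply: eq_integral => y _.
  rewrite -ge0_mule_fsuml => [|r]; last exact: nnfun_muleindic_ge0.
  by rewrite fsumEFin // -(fimfunE _ y).
rewrite ge0_integral_fsum//; last 2 first.
- move=> r; apply: emeasurable_funM; last exact/measurable_EFinP.
  apply/measurable_EFinP; apply: measurable_funM => //.
- move=> r y Ey; rewrite mule_ge0 ?lee_fin ?g0//.
  exact: nnfun_muleindic_ge0.
apply: eq_fsbigr => r /[!inE] -[t _ <-]; set A := h @^-1` _.
have mDA : measurable (D `&` X @^-1` A) by exact: mX mD _ (mA _).
(* Both sides meet in the middle: on [D], the indicator of [A] at [X w] is that of [D] intersected
   with the preimage of [A], whose measure [lawX] gives. *)
transitivity ((h t)%:E * \int[nu]_(y in E `&` A) (g y)%:E).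
  rewrite -lawX; last exact: mA.
  transitivity (\int[mu]_(w in D) ((h t)%:E * (\1_(D `&` X @^-1` A) w)%:E)).
    apply: eq_integral => w Dw; rewrite EFinM; congr (_ * (_)%:E).
    by rewrite !indicE in_setI Dw.
  rewrite ge0_integralZl//.
  - by rewrite integral_indic// setIAC setIid.
  - by apply/measurable_EFinP; exact: measurable_indic.
  - by rewrite lee_fin.
rewrite integral_mkcondr -ge0_integralZl//.
- apply: eq_integral => y _; rewrite EFinM -muleA; congr (_ * _).
  by rewrite epatch_indic muleC.
- apply/(measurable_restrict _ (mA _) mE)/measurable_EFinP.
  exact: measurable_funS mg.
- by move=> y Ey; rewrite patchE; case: ifP => // _; rewrite lee_fin g0.
- by rewrite lee_fin.
Qed.

(** Monotone convergence, applied to both integrals along the same increasing simple approximations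
    of [f], extends the simple case. *)
Lemma ge0_integral_law (f : T2 -> \bar R) :
  measurable_fun E f -> (forall y, E y -> 0 <= f y) ->
  \int[mu]_(w in D) f (X w) = \int[nu]_(y in E) (f y * (g y)%:E).
Proof.
move=> mf f0; pose h := nnsfun_approx mE mf.
have fE y : E y -> f y = lim ((h n y)%:E @[n --> \oo]).
  by move=> Ey; apply/esym/cvg_lim => //; exact: cvg_nnsfun_approx.
have fgE y : E y -> f y * (g y)%:E = lim ((h n y)%:E * (g y)%:E @[n --> \oo]).
  move=> Ey; apply/esym/cvg_lim => //; apply: cvgeZr => //.
  exact: cvg_nnsfun_approx.
under eq_integral => w /[!inE] /XE /fE -> do [].
under [RHS]eq_integral => y /[!inE] /fgE -> do [].
rewrite monotone_convergence//; last 3 first.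
- move=> n; apply/measurable_EFinP.
  exact: (measurable_comp measurableT).
- by move=> n w _; rewrite lee_fin.
- move=> w Dw a b ab; rewrite lee_fin; exact/lefP/nd_nnsfun_approx.
rewrite monotone_convergence//; last 3 first.
- move=> n; apply: emeasurable_funM; apply/measurable_EFinP => //.
  exact: measurable_funTS.
- by move=> n y Ey; rewrite mule_ge0// lee_fin// g0.
- move=> y Ey a b ab; rewrite lee_wpmul2r ?lee_fin ?g0//.
  exact/lefP/nd_nnsfun_approx.
by under eq_fun do rewrite integral_law_nnsfun.
Qed.

End LawWithDensity.

(** * Transmission and outgoing angle of a single photon *)

Section SinglePhoton.
Context (R : realType) (d : measure_display) (T : measurableType d).
Variables (P : probability T R) (J : interval R).

(* Scaling by [P E] makes the null case [P E = 0], where [rho] is arbitrary,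
   uniform with the general one. *)
Lemma cond_density_scaled (E : set T) (X : T -> R) (rho : R -> R) :
  measurable E -> measurable_fun E X -> cond_density P J E X rho ->
  let g y := fine (P E) * rho y in
  [/\ measurable_fun [set` J] g,
      (forall y, [set` J] y -> 0 <= g y) &
      (forall B, measurable B -> P (E `&` X @^-1` B) =
        \int[lebesgue_measure]_(y in [set` J] `&` B) (g y)%:E)%E].
Proof.
move=> mE mX dens /=.
have mEX B : measurable B -> measurable (E `&` X @^-1` B) by exact: mX.
have [P0|P0] := eqVneq (P E) 0%E.
  rewrite P0 /=; split=> [|y _|B mB].
  - by rewrite (_ : (fun y => _) = cst 0)//; apply/funext => y; rewrite mul0r.
  - by rewrite mul0r.
  - rewrite [LHS](@subset_measure0 _ _ _ P _ E)//; last exact: mEX.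
    by under eq_integral do rewrite mul0r; rewrite integral0.
have [mrho rho0 lawX] := dens P0.
have P00 : fine (P E) != 0.
  apply: contra P0 => /eqP P0.
  by rewrite -(@fineK _ (P E)) ?P0 ?fin_num_measure.
split=> [|y Jy|B mB].
- exact: measurable_funM.
- by rewrite mulr_ge0// ?rho0// fine_ge0.
- under eq_integral do rewrite EFinM.
  rewrite ge0_integralZl//.
  + rewrite -lawX// -EFinM mulrCA divff// mulr1 fineK// fin_num_measure//.
    exact: mEX.
  + exact: measurableI.
  + apply/measurable_EFinP; exact: measurable_funS mrho.
  + by move=> y [Jy _]; rewrite lee_fin rho0.
  + by rewrite lee_fin fine_ge0.
Qed.

Variables (M : nat) (alpha : 'I_M -> R).
Variables (PTs : 'I_M -> R -> R -> R) (rhoCs : 'I_M -> R -> R -> R -> R).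
Hypotheses (HPTs : transmission_probabilities J PTs).
Hypotheses (HrhoCs : change_densities J rhoCs).
Variables (rhoS : nat -> R -> R) (reach : nat -> set T) (theta : nat -> T -> R).
Hypothesis Hphoton : photon P J alpha PTs rhoCs (rhoS 0%N) reach theta.
Hypothesis HrhoS : forall i : 'I_M.+1,
  cond_density P J (reach i) (theta i) (rhoS i).

Let p i := fine (P (reach i)).

Lemma measurable_reach (k : nat) : (k <= M)%N -> measurable (reach k).
Proof.
move=> kM.
exact: (photon_measurable_reach Hphoton (Ordinal (kM : k < M.+1)%N)).
Qed.

Lemma scaled_density (k : nat) : (k <= M)%N ->
  [/\ measurable_fun [set` J] (fun y => p k * rhoS k y),
      (forall y, [set` J] y -> 0 <= p k * rhoS k y) &
      (forall B, measurable B -> P (reach k `&` theta k @^-1` B) =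
        \int[lebesgue_measure]_(y in [set` J] `&` B) (p k * rhoS k y)%:E)%E].
Proof.
move=> kM; pose k' : 'I_M.+1 := Ordinal (kM : k < M.+1)%N.
exact: (cond_density_scaled (measurable_reach kM)
  (photon_measurable_theta Hphoton (i:=k')) (HrhoS (i:=k'))).
Qed.

(** The transmission rule is applied to the whole event [reach i], and the integral over photons is
    then carried to [J]. This is a recursion for [p] whose data, apart from [p i] itself, are the
    same for every photon. *)
Lemma reach_succ (i : 'I_M) :
  P (reach i.+1) = (\int[lebesgue_measure]_(x in [set` J])
    ((PTs i x (alpha i))%:E * (p i * rhoS i x)%:E))%E.
Proof.
have [mg g0 law] := scaled_density (ltnW (ltn_ord i)).
pose i' : 'I_M.+1 := Ordinal (ltnW (ltn_ord i) : i < M.+1)%N.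
have [mPT PT01] := HPTs i (alpha i).
rewrite -(ge0_integral_law (nu := lebesgue_measure)
  (measurable_reach (ltnW (ltn_ord i))) _
  (photon_measurable_theta Hphoton (i:=i')) (photon_range Hphoton (i:=i'))
  mg g0 law (f := fun x => (PTs i x (alpha i))%:E))//; last 2 first.
- exact/measurable_EFinP.
- by move=> x /PT01 /andP[]; rewrite lee_fin.
rewrite -(photon_transmission Hphoton).
  by rewrite setIidr//; exact: (photon_absorbed Hphoton).
by exists setT => //; rewrite preimage_setT setIT.
Qed.

(* When the outgoing density does not depend on the incoming angle, the inner
   integral in [photon_change] is constant on the event conditioned upon. *)
Lemma outgoing_density (i : 'I_M) (x0 : R) : x0 \in J ->
  (forall x y, x \in J -> y \in J ->
     rhoCs i x y (alpha i) = rhoCs i x0 y (alpha i)) ->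
  {ae lebesgue_measure, forall y : R, y \in J ->
     p i.+1 * rhoS i.+1 y = p i.+1 * rhoCs i x0 y (alpha i)}.
Proof.
move=> Jx0 rhoCE.
have [mg g0 law] := scaled_density (ltn_ord i).
have [mC C0 C1] := HrhoCs i (alpha i).
have mc : measurable_fun [set` J] (fun y => rhoCs i x0 y (alpha i)).
  apply: (@measurable_comp _ _ _ _ _ _ ([set` J] `*` [set` J])
    (fun q : R * R => rhoCs i q.1 q.2 (alpha i)) _ (fun y => (x0, y))) => //.
  - exact: measurableX.
  - by move=> _ [y Jy <-].
  - exact: measurable_funTS (pair1_measurable x0).
have mR := measurable_reach (ltn_ord i).
pose i' : 'I_M.+1 := Ordinal (ltnW (ltn_ord i) : i < M.+1)%N.
have P_fin : P (reach i.+1) = (p i.+1)%:E by rewrite fineK// fin_num_measure.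
(* Equal integrals over all measurable subsets of [J] will give equality almost everywhere. *)
have intc B : measurable B -> B `<=` [set` J] ->
    (\int[lebesgue_measure]_(y in B) (p i.+1 * rhoS i.+1 y)%:E =
     \int[lebesgue_measure]_(y in B) (p i.+1 * rhoCs i x0 y (alpha i))%:E)%E.
  move=> mB BJ; rewrite -{1}(setIidr BJ) -law//.
  rewrite (photon_change Hphoton mB); last first.
    by exists setT => //; rewrite preimage_setT setIT.
  rewrite setIidr//.
  under [RHS]eq_integral do rewrite EFinM.
  rewrite [RHS]ge0_integralZl//; last 3 first.
  - by apply/measurable_EFinP; exact: measurable_funS mc.
  - by move=> y /BJ Jy; rewrite lee_fin C0.
  - by rewrite lee_fin fine_ge0.
  (* Read as the measure of [reach i.+1], the factor [p i.+1] becomes the integral of a constant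
     over that event. The integrands then agree pointwise, since [theta i w] may be replaced by
     [x0]. *)
  rewrite -P_fin muleC -integral_cst//; apply: eq_integral => w /[!inE] Rw.
  apply: eq_integral => y /[!inE] /BJ Jy; rewrite rhoCE//.
  exact/(photon_range Hphoton (i := i'))/(photon_absorbed Hphoton).
have : ae_eq lebesgue_measure [set` J]
    (fun y => (p i.+1 * rhoS i.+1 y)%:E)
    (fun y => (p i.+1 * rhoCs i x0 y (alpha i))%:E).
  apply: integral_ae_eq => //.
  (* The integral over all of [J] is the probability of [reach i.+1], hence finite. *)
  - apply/integrableP; split; first exact/measurable_EFinP.
    under eq_integral => y /[!inE] /g0 y0 do rewrite gee0_abs//.
    by rewrite -[X in integral _ X]setIT -law// ltey_eq fin_num_measure//
      preimage_setT setIT.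
  - by apply/measurable_EFinP; exact: measurable_funM.
  - by move=> B BJ mB; exact: intc.
by apply: filterS => y yE Jy; have [] := yE Jy.
Qed.

End SinglePhoton.

(** * From one photon to expected counts *)

Lemma expected_photonsE (R : realType) (d : measure_display)
    (T : measurableType d) (P : probability T R) (N0 : nat)
    (reach : 'I_N0 -> nat -> set T) (k : nat) :
  (forall j, measurable (reach j k)) ->
  expected_photons P reach k = \sum_(j < N0) fine (P (reach j k)).
Proof.
move=> mR; rewrite /expected_photons unlock.
under eq_integral do rewrite -sumEFin.
rewrite ge0_integral_sum//; last first.
  by move=> j; exact: (measurableT_comp _ (measurable_indic (mR j))).
have intE j : (\int[P]_w (\1_(reach j k) w)%:E = P (reach j k))%E.
  by rewrite integral_indic// setIT.
by rewrite -sum_fine => [|j _]; [apply: eq_bigr => j _|];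
  rewrite intE// fin_num_measure.
Qed.

Theorem mainTheorem7 (R : realType) (d : measure_display)
    (T : measurableType d) (P : probability T R)
    (J : interval R) (HJ : lebesgue_measure [set` J] = (2 * pi)%:E)
    (M : nat) (HM : (1 <= M)%N) (N0 : nat) (HN0 : N0 <> 0%N)
    (alpha : 'I_M -> R)
    (PTs : 'I_M -> R -> R -> R) (rhoCs : 'I_M -> R -> R -> R -> R)
    (PT : R -> R -> R) (rhoC : R -> R -> R -> R)
    (HPTs : transmission_probabilities J PTs)
    (HrhoCs : change_densities J rhoCs)
    (Hcase3 : case3 J PTs rhoCs PT rhoC)
    (reach : 'I_N0 -> nat -> set T) (theta : 'I_N0 -> nat -> T -> R)
    (rhoS : nat -> R -> R)
    (Hphoton : forall j : 'I_N0,
       photon P J alpha PTs rhoCs (rhoS 0%N) (reach j) (theta j))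
    (Hindep : independent_photons P M reach theta)
    (HrhoS : forall (j : 'I_N0) (i : 'I_M.+1),
       cond_density P J (reach j i) (theta j i) (rhoS i)) :
  let N := expected_photons P reach in
  forall i : 'I_M,
    {ae lebesgue_measure, forall y : R, y \in J ->
      (N i.+1 / N0%:R * rhoS i.+1 y)%:E =
      (\int[lebesgue_measure]_(x in [set` J])
         (N i / N0%:R * rhoS i x * PT x (alpha i) * rhoC x y (alpha i))%:E)%E}.
Proof.
move=> N i.
(* [J] has length [2 * pi], which is nonzero, so it is nonempty; [x0] is a reference incoming
   angle. *)
have [x0 Jx0] : exists x0, x0 \in J.
  have [J0|/set0P[x Jx]] := eqVneq [set` J] set0; last by exists x.
  move: HJ; rewrite J0 measure0 => -[/esym/eqP].
  by rewrite mulf_eq0 pnatr_eq0/= gt_eqF// pi_gt0.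
have N0_gt0 : (0 < N0)%N by rewrite lt0n; apply/eqP.
pose j0 : 'I_N0 := Ordinal N0_gt0; pose p k := fine (P (reach j0 k)).
(* All photons start with probability 1 at surface 0 and obey the same recursion [reach_succ], so
   [j0] represents them all. *)
have reachE k : (k <= M)%N -> forall j, fine (P (reach j k)) = p k.
  elim: k => [_ j|k IH kM j]; first by rewrite /p !(photon_start (Hphoton _)).
  rewrite /p !(reach_succ HPTs (Hphoton _) (HrhoS _) (Ordinal kM))/=.
  by rewrite !IH// ltnW.
have NE k : (k <= M)%N -> N k / N0%:R = p k.
  move=> kM; rewrite /N expected_photonsE => [|j]; last first.
    exact: (measurable_reach (Hphoton j)).
  rewrite (eq_bigr (fun=> p k)) => [|j _]; last exact: reachE.
  rewrite sumr_const card_ord -[_ *+ _]mulr_natr mulfK//.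
  by rewrite pnatr_eq0; apply/eqP.
have [rhoC_in PTE rhoCE] := Hcase3.
have := @outgoing_density _ _ _ _ _ _ _ _ _ HrhoCs _ _ _ (Hphoton j0)
  (HrhoS j0) i x0 Jx0 (fun x y Jx Jy => rhoC_in i x x0 y (alpha i) Jx Jx0 Jy).
apply: filterS; first exact: (ae_filter_ringOfSetsType lebesgue_measure).
move=> y yE Jy.
rewrite (NE _ (ltn_ord i)) (NE _ (ltnW (ltn_ord i))) yE//.
have [mg g0 _] := scaled_density (Hphoton j0) (HrhoS j0) (ltnW (ltn_ord i)).
have [mPT PT01] := HPTs i (alpha i).
have [_ C0 _] := HrhoCs i (alpha i).
(* Freezing the incoming angle at [x0] makes the outgoing density constant in [x], so it leaves the
   integral. *)
transitivity (\int[lebesgue_measure]_(x in [set` J])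
  ((rhoCs i x0 y (alpha i))%:E *
   ((PTs i x (alpha i))%:E * (p i * rhoS i x)%:E)))%E; last first.
  apply: eq_integral => x /[!inE] Jx.
  rewrite -(rhoC_in i x)// rhoCE// PTE// -!EFinM.
  by congr (_%:E); rewrite mulrC [PT _ _ * _]mulrC.
rewrite ge0_integralZl//; last 3 first.
- by apply: emeasurable_funM; exact/measurable_EFinP.
- move=> x Jx; have /andP[PT0 _] := PT01 x Jx.
  by rewrite mule_ge0// lee_fin// g0.
- by rewrite lee_fin C0.
(* The remaining integral is the probability of reaching surface [i.+1], which is the factor
   [p i.+1] on the left. *)
rewrite -(reach_succ HPTs (Hphoton j0) (HrhoS j0)) EFinM fineK 1?muleC//.
rewrite fin_num_measure//.
exact: (measurable_reach (Hphoton j0) (ltn_ord i)).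
Qed.
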